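(* For $n\ge 1$, the number of $3$-noncrossing partitions of $[n]$ is $$C_3(n)=\sum_{j=1}^n \frac{4\,(n-1)!\;n!\;(2j)!}{(j-1)!\;j!\;(j+1)!\;(j+4)!\;(n-j)!\;(n-j+2)!}\,P(j,n)$$ with $$P(j,n)=24+18n+(5-13n)\,j+(11n+20)\,j^2+(10n-2)\,j^3+(4n-11)\,j^4-6j^5.$$
   Context: A partition of $[n]=\{1,2,\ldots,n\}$ is a collection of nonempty, mutually disjoint subsets (blocks) of $[n]$ whose union is $[n]$. The standard representation of a partition $P$ of $[n]$ is the graph on vertex set $[n]$ whose edges are the pairs $(i,j)$ with $i<j$ such that $i$ and $j$ are in the same block of $P$ and are consecutive in that block (no element of the block lies strictly between $i$ and $j$). A $k$-crossing of $P$ is a collection of $k$ edges $(i_1,j_1),\ldots,(i_k,j_k)$ of its standard representation such that $i_1<i_2<\cdots<i_k<j_1<j_2<\cdots<j_k$. A partition is $k$-noncrossing if it has no $k$-crossing. $C_3(n)$ denotes the number of $3$-noncrossing partitions of $[n]$. *)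

(* Defs.v *)
From HB Require Import structures.
From mathcomp Require Import all_boot all_order all_algebra.

Set Implicit Arguments.
Unset Strict Implicit.
Unset Printing Implicit Defensive.

Import GRing.Theory.

(* The ground set {1, ..., n} is represented by 'I_n = {0, ..., n-1}, its
   translate by -1: arcs and crossings only involve the order of the points. *)
Definition arc (n : nat) (P : {set {set 'I_n}}) (e : 'I_n * 'I_n) : bool :=
  (e.1 < e.2) &&
  [exists B in P,
     [&& e.1 \in B, e.2 \in B & [forall l in B, ~~ (e.1 < l < e.2)]]].

(* The sorted list is i_1, ..., i_k, j_1, ..., j_k. *)
Definition crossing (n k : nat) (P : {set {set 'I_n}})
    (e : k.-tuple ('I_n * 'I_n)) : bool :=
  all (arc P) e &&
  sorted ltn ([seq val a.1 | a <- e] ++ [seq val a.2 | a <- e]).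

Definition noncrossing (k n : nat) (P : {set {set 'I_n}}) : bool :=
  [forall e : k.-tuple ('I_n * 'I_n), ~~ crossing P e].

Definition num_noncrossing (k n : nat) : nat :=
  #|[set P : {set {set 'I_n}} | partition P [set: 'I_n] & noncrossing k P]|.

Local Open Scope ring_scope.

Definition Ppoly (j n : rat) : rat :=
  24 + 18 * n + (5 - 13 * n) * j + (11 * n + 20) * j ^+ 2
  + (10 * n - 2) * j ^+ 3 + (4 * n - 11) * j ^+ 4 - 6 * j ^+ 5.

(* Main.v *)
(* Scan the vertices from right to left and let each new vertex choose its successor.
   A vertex in the middle of a 2-crossing can never receive an arc again, so the number
   of ways to continue depends only on the remaining vertices and on which of them
   die when one of them is chosen. This number is a sum, over words of 1s and 2s in
   those vertices with a parenthesis-matching constraint, of the number of ways to walk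
   from the shape of the word to the empty shape among partitions with two rows, each
   step being (remove a cell or stay) followed by (add a cell or stay).

   Shifting the walk by half a step, adding before removing, turns it into the walk
   with generating function (1 + x + y)(1 + 1/x + 1/y), on hexagonal steps, in a wedge
   of angle pi/6. All of its boundary conditions are then exactly those of the reflection
   principle for the dihedral group of order 12, and the count becomes an alternating
   sum of twelve coefficients of ((1 + x + y)(1 + 1/x + 1/y))^(n-1). Each of them is a single
   hypergeometric sum, and the combination differs from the claimed one by a
   telescoping sum. *)
Require Import Defs.
From HB Require Import structures.
From mathcomp Require Import all_boot all_order all_algebra.
From mathcomp Require Import zify ring lra.
Import GRing.Theory Num.Theory.

(** * Words and two-row shapes *)

(* A partition with two rows b <= a is given by h = a - b and b; [up] and [down]
   sum a function over the partitions obtained by adding or removing one cell. *)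
Definition up (g : nat -> nat -> nat) (h b : nat) : nat :=
  g h.+1 b + (if h is h'.+1 then g h' b.+1 else 0).

Definition down (g : nat -> nat -> nat) (h b : nat) : nat :=
  (if h is h'.+1 then g h' b else 0) + (if b is b'.+1 then g h.+1 b' else 0).

Definition stay (T : (nat -> nat -> nat) -> nat -> nat -> nat) g h b : nat :=
  g h b + T g h b.

Definition shift1 (g : nat -> nat -> nat) (h b : nat) : nat := g h b.+1.

Definition cut1 (g : nat -> nat -> nat) (h b : nat) : nat :=
  if h is h'.+1 then g h' b.+1 else 0.

(* A state lists the available vertices from left to right, each as a pair (x, t)
   of its position and its threshold. Words have letters -, 1, 2, one for each
   vertex; a letter 2 at (x, t) is matched with the closest unmatched 1 to its left,
   whose position must be less than t. The sum is that of g h b, where h is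
   the number of unmatched 1s and b that of 2s; the stack [st] records the
   positions of the 1s read before L that are still unmatched. *)
Fixpoint wsum (st : seq nat) (L : seq (nat * nat)) (g : nat -> nat -> nat) : nat :=
  match L with
  | [::] => g (size st) 0
  | (x, t) :: L' => wsum st L' g + wsum (x :: st) L' g +
      (if st is y :: st' then if y < t then wsum st' L' (shift1 g) else 0 else 0)
  end.

(* The same sum restricted to the words in which the whole of [st], and then one
   more 1 below it that is free of constraints, get matched. *)
Fixpoint ksum (st : seq nat) (L : seq (nat * nat)) (g : nat -> nat -> nat) : nat :=
  match L with
  | [::] => 0
  | (x, t) :: L' => ksum st L' g + ksum (x :: st) L' g +
      (if st is y :: st' then if y < t then ksum st' L' (shift1 g) else 0
       else wsum [::] L' (shift1 g))
  end.

Lemma eq_wsum st L g g' : (forall h b, g h b = g' h b) -> wsum st L g = wsum st L g'.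
Proof.
elim: L st g g' => [|[x t] L IH] st g g' e //=.
rewrite !(IH _ _ _ e); case: st => [|y st] //.
by rewrite (IH st (shift1 g) (shift1 g')) // => h b; apply: e.
Qed.

Lemma wsumD st L g1 g2 :
  wsum st L (fun h b => g1 h b + g2 h b) = wsum st L g1 + wsum st L g2.
Proof.
elim: L st g1 g2 => [|[x t] L IH] st g1 g2 //=.
rewrite !IH; case: st => [|y st]; first by lia.
case: ifP => _; last by lia.
have -> : wsum st L (shift1 (fun h b => g1 h b + g2 h b))
        = wsum st L (fun h b => shift1 g1 h b + shift1 g2 h b) by [].
rewrite IH; lia.
Qed.

Definition free (L : seq (nat * nat)) (y : nat) := all (fun q => y < q.2) L.

(** The entry z at the bottom of the stack stays unmatched, giving [h.+1], or is matched after the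
    whole of [st]; being free, it passes any threshold test, and [ksum] counts these words. *)
Lemma wsum_rcons_free st z L g : free L z ->
  wsum (rcons st z) L g = wsum st L (fun h b => g h.+1 b) + ksum st L g.
Proof.
elim: L st g => [|[x t] L IH] st g /=; first by rewrite size_rcons addn0.
case/andP=> zt fz; rewrite -rcons_cons !IH //.
case: st => [|y st] /=.
  by rewrite zt; ring.
case: ifP => _; last by ring.
have -> : wsum st L (shift1 (fun h b => g h.+1 b))
        = wsum st L (fun h b => shift1 g h.+1 b) by [].
by rewrite IH //; ring.
Qed.

(** Turn the leftmost unmatched 1 into a 2, matched with an extra unconstrained 1. In the first
    equation this 1 is z if z stays unmatched, and a later letter if the whole stack gets
    matched. *)
Lemma wsum_cut1 L g :
  (forall st z, wsum (rcons st z) L (cut1 g) = ksum (rcons st z) L g + wsum st L (shift1 g))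
  /\ wsum [::] L (cut1 g) = ksum [::] L g.
Proof.
elim: L g => [|[x t] L IH] g; first by split=> // st z /=; rewrite size_rcons.
have [IH1 IH2] := IH g; have [IH1' IH2'] := IH (shift1 g).
split=> [st z|] /=; last first.
  by rewrite IH2 (IH1 [::] x) /=; lia.
rewrite -rcons_cons !IH1; case: st => [|y st] /=; first by case: ifP; rewrite ?IH2'; lia.
case: ifP => _; last by lia.
have -> : wsum (rcons st z) L (shift1 (cut1 g)) = wsum (rcons st z) L (cut1 (shift1 g)) by [].
by rewrite IH1'; lia.
Qed.

(** Free entries pass every threshold test, so at the bottom of the stack only their number
    matters. *)
Lemma wsum_free s st st' L g : size st = size st' -> all (free L) st -> all (free L) st' ->
  wsum (s ++ st) L g = wsum (s ++ st') L g.
Proof.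
elim: L s st st' g => [|[x t] L IH] s st st' g e f f' /=; first by rewrite !size_cat e.
have fL u : all (free ((x, t) :: L)) u -> all (free L) u.
  by apply: sub_all => y /andP[].
rewrite (IH s st st') ?fL // -!cat_cons (IH _ st st') ?fL //; congr (_ + _).
case: s => [|y s] /=; last by case: ifP => // _; apply: IH; rewrite ?fL.
case: st st' e f f' => [|y st] [|y' st'] //= [e] /andP[/andP[-> _] f] /andP[/andP[-> _] f'].
by apply: (IH [::]); rewrite ?fL.
Qed.

(* As long as no 2 was read, one may stop at any vertex whose threshold exceeds
   all positions on the stack, discard it and read the remaining vertices freely. *)
Fixpoint rsum (st : seq nat) (L : seq (nat * nat)) (g : nat -> nat -> nat) : nat :=
  match L with
  | [::] => 0
  | (x, t) :: L' => rsum st L' g + rsum (x :: st) L' g +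
      (if (st == [::]) || (head 0 st < t) then wsum st L' g else 0)
  end.

(* Bijectively: to remove a cell of the second row, erase the first 2. To remove a
   cell of the first row, erase the first unmatched 1 if it precedes every 2;
   otherwise erase the first 2 and turn the first unmatched 1 into a 2. *)
Lemma wsum_down L g : sorted leq (unzip2 L) ->
  (forall st z, sorted ltn (catrev (rcons st z) (unzip1 L)) ->
     wsum (rcons st z) L (down g) = rsum (rcons st z) L g + wsum st L g)
  /\ (sorted ltn (unzip1 L) -> wsum [::] L (down g) = rsum [::] L g).
Proof.
elim: L g => [|[x t] L IH] g /=.
  by move=> _; split=> // st z _; rewrite size_rcons /down addn0.
move=> tL; have [IH1 IH2] := IH g (path_sorted tL).
have fL y : y < t -> free L y.
  move=> yt; apply/allP => q qL; apply: leq_trans yt _.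
  by move/(order_path_min leq_trans)/allP: tL; apply; apply: map_f.
have drop s : sorted ltn (catrev s (x :: unzip1 L)) -> sorted ltn (catrev s (unzip1 L)).
  apply: subseq_sorted; first exact: ltn_trans.
  by rewrite !catrevE cat_subseq // subseq_cons.
split=> [st z sL|sL]; last first.
  rewrite (IH1 [::] x) //= IH2 ?(path_sorted sL) //; ring.
rewrite IH1 ?drop // -rcons_cons IH1 //.
have sd (h b : nat) : shift1 (down g) h b = cut1 g h b + g h.+1 b by [].
case: st sL => [|y st] sL /=.
  case: ifP => zt; last by ring.
  rewrite (eq_wsum _ _ _ _ sd) wsumD (wsum_cut1 L g).2.
  have := @wsum_rcons_free [::] z L g (fL z zt); rewrite /= => ->; ring.
case: ifP => yt; last by ring.
rewrite (eq_wsum _ _ _ _ sd) wsumD (wsum_cut1 L g).1.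
have fy := fL y yt.
(* The stack decreases from its head y, so y < t and the monotone thresholds make all entries free.
   Hence y may sink to the bottom, where its being matched or not splits the sum. *)
have -> : wsum (y :: rcons st z) L g = wsum (rcons (rcons st z) y) L g.
  have fs : all (free L) (y :: rcons st z).
    have := sL; rewrite catrevE => /(subseq_sorted ltn_trans (prefix_subseq _ _)).
    rewrite rev_sorted => /= /(order_path_min (rev_trans ltn_trans))/allP sy.
    rewrite /= fy; apply/allP => u /sy uy.
    by apply: fL; apply: ltn_trans yt.
  apply: (@wsum_free [::]) => //; first by rewrite /= !size_rcons.
  by rewrite all_rcons.
by rewrite (wsum_rcons_free (rcons st z) y) //; ring.
Qed.

(** * Choosing the successor of a new vertex *)

(** Vertices of threshold 0 carry no letter 2, so each is either skipped or pushed on the stack. *)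
Fixpoint choices (pre : seq nat) (st : seq nat) (F : seq nat -> nat) : nat :=
  if pre is x :: pre' then choices pre' st F + choices pre' (x :: st) F else F st.

(* The available vertices after (x, t) received an arc from a new leftmost vertex:
   those to the left of x are now covered by that arc, and those of them that are
   not below t lie in the middle of a 2-crossing. *)
Definition closed_at (L : seq (nat * nat)) (x t : nat) : seq (nat * nat) :=
  [seq (q.1, if q.1 < x then 0 else q.2) | q <- L & (q.1 < minn x t) || (x < q.1)].

Lemma choicesD pre st F F' :
  choices pre st (fun s => F s + F' s) = choices pre st F + choices pre st F'.
Proof. by elim: pre st => //= x pre IH st; rewrite !IH; ring. Qed.

Lemma choices0 pre st : choices pre st (fun=> 0) = 0.
Proof. by elim: pre st => //= x pre IH st; rewrite !IH. Qed.

Lemma choices_rcons pre x st F :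
  choices (rcons pre x) st F = choices pre st (fun s => F s + F (x :: s)).
Proof. by elim: pre st => //= y pre IH st; rewrite !IH. Qed.

Lemma wsum_zero_thresholds pre st L g :
  wsum st ([seq (y, 0) | y <- pre] ++ L) g = choices pre st (fun s => wsum s L g).
Proof. by elim: pre st => //= y pre IH st; rewrite !IH; case: st => *; rewrite ?addn0. Qed.

(** Positions are pushed in increasing order, so once one not below t is chosen, the head of the
    stack stays not below t. *)
Lemma choices_filter pre t st F : sorted ltn pre -> all (ltn^~ t) st ->
  choices [seq y <- pre | y < t] st F
  = choices pre st (fun s => if (s == [::]) || (head 0 s < t) then F s else 0).
Proof.
elim: pre st => [|x pre IH] st /= sp ast.
  by case: st ast => //= y st /andP[-> _].
have [xt|tx] /= := ltnP x t; first by rewrite !IH ?(path_sorted sp) //= xt.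
rewrite IH ?(path_sorted sp) //.
rewrite -[LHS]addn0; congr (_ + _); apply/esym.
have : all (leq t) (x :: pre).
  rewrite /= tx; apply/allP => y yp; apply: leq_trans tx (ltnW _).
  by move: y yp; apply/allP; exact: (order_path_min ltn_trans).
move=> {IH sp ast tx}; move: st x; elim: pre => [|y pre IH] st x /= /andP[tx].
  by rewrite ltnNge tx.
by case/andP=> ty tp; rewrite !IH /= ?tx ?ty.
Qed.

Lemma closed_at_cat pre x t post : sorted ltn (unzip1 (pre ++ (x, t) :: post)) ->
  closed_at (pre ++ (x, t) :: post) x t
  = [seq (y, 0) | y <- [seq y <- unzip1 pre | y < t]] ++ post.
Proof.
rewrite /unzip1 map_cat -/(unzip1 _) /= (sorted_pairwise ltn_trans) pairwise_cat /=.
case/and3P=> /allrelP pl _ /andP[/allP xl _].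
rewrite /closed_at filter_cat map_cat /= ltn_min !ltnn /=; congr (_ ++ _).
  rewrite filter_map -map_comp -!/(unzip1 _).
  have -> : [seq q <- pre | (q.1 < minn x t) || (x < q.1)] = [seq q <- pre | q.1 < t].
    apply: eq_in_filter => q qp; have /= := pl q.1 x (map_f _ qp) (mem_head _ _).
    by rewrite ltn_min; lia.
  apply/eq_in_map => q; rewrite mem_filter => /andP[_ qp].
  by rewrite (pl q.1 x (map_f _ qp) (mem_head _ _)).
have -> : [seq q <- post | (q.1 < minn x t) || (x < q.1)] = post.
  by apply/all_filterP/allP => q qp; rewrite (xl _ (map_f _ qp)) orbT.
rewrite -[RHS]map_id; apply/eq_in_map => q qp.
by have /= xq := xl _ (map_f _ qp); rewrite ltnNge (ltnW xq); case: q {qp xq}.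
Qed.

(** The chosen successor is the vertex discarded in [rsum]. On its left the thresholds become 0, so
    no 2 is read there, and dropping the positions not below t is the test on the head of the
    stack. *)
Lemma sum_wsum_closed_at L g : sorted ltn (unzip1 L) ->
  \sum_(q <- L) wsum [::] (closed_at L q.1 q.2) g = rsum [::] L g.
Proof.
move=> sL.
suff H pre M : L = pre ++ M -> \sum_(q <- M) wsum [::] (closed_at L q.1 q.2) g
    = choices (unzip1 pre) [::] (fun s => rsum s M g) by exact: (H [::]).
elim: M pre => [|[x t] M IH] pre e; first by rewrite big_nil /= choices0.
rewrite big_cons (IH (rcons pre (x, t))) ?cat_rcons //=.
rewrite (choicesD _ _ (fun s => rsum s M g + rsum (x :: s) M g)).
rewrite /unzip1 map_rcons choices_rcons -/(unzip1 _) addnC; congr (_ + _).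
have sl : sorted ltn (unzip1 (pre ++ (x, t) :: M)) by rewrite -e.
rewrite {1}e closed_at_cat // wsum_zero_thresholds choices_filter //.
by move: sl; rewrite /unzip1 map_cat => /cat_sorted2[].
Qed.

Definition shift_state (L : seq (nat * nat)) := [seq (q.1.+1, q.2.+1) | q <- L].

(** The new vertex has nothing on its left, hence threshold 0; after the shift it is below all other
    thresholds. *)
Definition opened (L : seq (nat * nat)) := (0, 0) :: shift_state L.

Lemma wsum_shift st L g : wsum (map S st) (shift_state L) g = wsum st L g.
Proof.
elim: L st g => [|[x t] L IH] st g /=; first by rewrite size_map.
rewrite -map_cons !IH; case: st => [|y st] //=.
by rewrite ltnS IH.
Qed.

(** A letter 1 at the new vertex is free. Unmatched, it adds a cell to the first row; matched, it
    accounts for a cell added to the second row, by [wsum_cut1]. *)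
Lemma wsum_opened L g : wsum [::] (opened L) g = wsum [::] L (stay up g).
Proof.
have fL : free (shift_state L) 0 by apply/allP => q /mapP[q' _ ->].
rewrite /= addn0 (@wsum_rcons_free [::]) //=.
rewrite (wsum_shift [::]) -(wsum_cut1 _ _).2 !(wsum_shift [::] L).
by rewrite -!wsumD.
Qed.

Definition good_state L := sorted ltn (unzip1 L) && sorted leq (unzip2 L).

(** The number of ways to add n vertices on the left: each ends its block or picks an available
    successor. *)
Fixpoint nb_desc (n : nat) (L : seq (nat * nat)) : nat :=
  if n is n'.+1 then
    nb_desc n' (opened L) + \sum_(q <- L) nb_desc n' (opened (closed_at L q.1 q.2))
  else 1.

Lemma good_opened L : good_state L -> good_state (opened L).
Proof.
rewrite /good_state /opened /= => /andP[s1 s2]; apply/andP; split.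
  rewrite path_min_sorted; last by apply/allP => q /mapP[? /mapP[? _ ->] ->].
  by rewrite /unzip1 -map_comp (map_comp S fst) (homo_sorted (e := ltn) (e' := ltn)).
rewrite path_min_sorted; last by apply/allP.
by rewrite /unzip2 -map_comp (map_comp S snd) (homo_sorted (e := leq) (e' := leq)).
Qed.

Lemma good_closed_at L q : good_state L -> q \in L -> good_state (closed_at L q.1 q.2).
Proof.
case: q => x t /andP[s1 s2] qL; case: (splitPr qL) s1 s2 => pre post s1 s2 /=.
rewrite closed_at_cat // /good_state; apply/andP; split.
  rewrite /unzip1 map_cat -map_comp map_id.
  apply: subseq_sorted s1; first exact: ltn_trans.
  rewrite /unzip1 map_cat; apply: cat_subseq; first exact: filter_subseq.
  exact: subseq_cons.
rewrite /unzip2 map_cat -map_comp.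
rewrite sorted_pairwise; last exact: leq_trans.
rewrite pairwise_cat; apply/and3P; split.
- by apply/allrelP => u v /mapP[? _ ->].
- by elim: [seq y <- unzip1 pre | y < t] => //= y s ->; rewrite andbT; apply/allP.
rewrite -sorted_pairwise; last exact: leq_trans.
by move: s2; rewrite /unzip2 map_cat => /cat_sorted2[_] /path_sorted.
Qed.

Fixpoint walks (n : nat) : nat -> nat -> nat :=
  if n is n'.+1 then stay down (stay up (walks n'))
  else fun h b => (h == 0) && (b == 0).

Lemma nb_desc_walks n L : good_state L -> nb_desc n L = wsum [::] L (walks n).
Proof.
elim: n L => [|n IH] L gL.
  (* Only the word without 1s and 2s survives: an unmatched 1 or a matched 2 leaves a non-empty
     shape. *)
  suff H st g : (forall h b, g h b.+1 = 0) -> (forall h, g h 0 = (h == 0)) ->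
      wsum st L g = (st == [::]).
    by rewrite H // => h *; rewrite /= ?andbF ?andbT.
  elim: L st g {gL} => [|[x t] L IH] st g g1 g0 /=; first by rewrite g0 size_eq0.
  rewrite !IH //= addn0; case: st => [|y st]; rewrite // ?addn0 //.
  case: ifP => // _; rewrite /= add0n.
  suff: forall st, wsum st L (shift1 g) = 0 by move->.
  move: g g1 {g0 IH}; elim: L => [|[u v] L IH] g g1 s //=; first by rewrite /shift1 g1.
  by rewrite !IH //; case: s => //= w s; case: ifP => // _; apply: IH => h b; apply: g1.
rewrite [LHS]/= IH ?good_opened // wsum_opened.
under eq_big_seq => q qL do rewrite IH ?good_opened ?good_closed_at // wsum_opened.
have [s1 s2] := andP gL.
by rewrite sum_wsum_closed_at // -(wsum_down _ _ s2).2 // -wsumD.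
Qed.

(** * Arc sequences *)

(* A partition is encoded by the sequence of the lengths of the arcs that start at
   each vertex, with 0 for the last element of a block. Relative lengths make the
   encoding stable under the addition of a new first vertex. *)
Fixpoint succ_arc (s : seq nat) (i j : nat) : bool :=
  match s, i with
  | [::], _ => false
  | x :: _, 0 => (0 < x) && (j == x)
  | _ :: s', i'.+1 => if j is j'.+1 then succ_arc s' i' j' else false
  end.

Lemma succ_arcE s i j :
  succ_arc s i j = [&& i < size s, 0 < nth 0 s i & j == i + nth 0 s i].
Proof.
elim: s i j => [|x s IH] [|i] [|j] //=; last by rewrite IH addSn eqSS.
by rewrite addSn !andbF.
Qed.

Lemma succ_arc_ltn {s i j} : succ_arc s i j -> i < j.
Proof. by rewrite succ_arcE => /and3P[_ ? /eqP->]; lia. Qed.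

Lemma succ_arc_fun {s i j j'} : succ_arc s i j -> succ_arc s i j' -> j = j'.
Proof. by rewrite !succ_arcE => /and3P[_ _ /eqP->] /and3P[_ _ /eqP->]. Qed.

Lemma succ_arcSn x s i j : succ_arc (x :: s) i.+1 j -> exists2 j', j = j'.+1 & succ_arc s i j'.
Proof. by case: j => // j; exists j. Qed.

(** An entry [b.+1] is an arc to position b of the tail, whose threshold is looked up in L. *)
Fixpoint state (s : seq nat) : seq (nat * nat) :=
  match s with
  | [::] => [::]
  | 0 :: s' => opened (state s')
  | b.+1 :: s' =>
      let L := state s' in opened (closed_at L b (nth 0 (unzip2 L) (index b (unzip1 L))))
  end.

Fixpoint legal (s : seq nat) : bool :=
  if s is x :: s' then legal s' && ((x == 0) || (x.-1 \in unzip1 (state s'))) else true.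

Definition targets_ok (s : seq nat) :=
  (forall i j, succ_arc s i j -> j < size s) /\
  (forall i i' j, succ_arc s i j -> succ_arc s i' j -> i = i').

Definition no_3crossing (s : seq nat) :=
  forall i1 i2 i3 j1 j2 j3, succ_arc s i1 j1 -> succ_arc s i2 j2 -> succ_arc s i3 j3 ->
  ~~ [&& i1 < i2, i2 < i3, i3 < j1, j1 < j2 & j2 < j3].

(* The vertices that can receive an arc from a new first vertex. *)
Definition usable (s : seq nat) (b : nat) :=
  [/\ b < size s, forall i, ~~ succ_arc s i b
    & forall i1 i2 j1 j2, succ_arc s i1 j1 -> succ_arc s i2 j2 ->
        ~~ [&& i1 < i2, i2 < b, b < j1 & j1 < j2]].

(* The threshold t of b tells which y < b still are usable after an arc from a new
   first vertex to b was added: those such that no arc starts before y and covers b. *)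
Definition state_spec (s : seq nat) (L : seq (nat * nat)) :=
  (forall b, b \in unzip1 L <-> usable s b) /\
  (forall b t y, (b, t) \in L -> y < b ->
     (y < t <-> forall i j, succ_arc s i j -> ~~ ((i < y) && (b < j)))).

Lemma succ_arc_cons x s i j : succ_arc (x :: s) i j ->
  (i = 0 /\ exists2 b, x = b.+1 & j = b.+1) \/
  exists i' j', [/\ i = i'.+1, j = j'.+1 & succ_arc s i' j'].
Proof.
case: i => [|i]; last by case/succ_arcSn=> j' -> ij; right; exists i, j'.
by case: x => //= x /eqP->; left; split=> //; exists x.
Qed.

(** The only new arc joins 0 to [b.+1]: it occupies b, and it crosses any arc that starts left of c
    < b and ends beyond b, around c. *)
Lemma usable_cons x s c : usable (x :: s) c.+1 <->
  usable s c /\ (forall b, x = b.+1 -> c <> b /\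
     (c < b -> forall i j, succ_arc s i j -> ~~ ((i < c) && (b < j)))).
Proof.
split=> [[cs cn cc]|[[cs cn cc] H]].
  split; last first.
    move=> b xb; split=> [cb|cb i j ij].
      by have := cn 0; rewrite xb cb /= eqxx.
    have := cc 0 i.+1 b.+1 j.+1; rewrite xb /= eqxx => /(_ isT ij).
    by rewrite !ltnS; lia.
  split=> // [i|i1 i2 j1 j2 a1 a2]; first exact: (cn i.+1).
  by have := cc i1.+1 i2.+1 j1.+1 j2.+1 a1 a2; rewrite !ltnS.
split=> // [i|i1 i2 j1 j2].
  apply/negP => /succ_arc_cons[[_ [b xb [cb]]]|[i' [j' [_ [<-]]]]].
    by have [] := H b xb.
  by apply/negP.
case/succ_arc_cons=> [[-> [b xb ->]]|[i1' [j1' [-> -> a1]]]].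
  case/succ_arc_cons=> [[-> _]|[i2' [j2' [-> -> a2]]]] //.
  rewrite !ltnS; have [_ Hb] := H b xb.
  by have [/Hb/(_ _ _ a2)|] := ltnP c b; lia.
case/succ_arc_cons=> [[-> _]|[i2' [j2' [-> -> a2]]]] //.
by rewrite !ltnS; apply: cc a1 a2.
Qed.

(** Common to both cases of [state]. For c < b the new arc covers c and starts before every vertex
    but the new one, so the threshold is reset to 0. *)
Lemma state_spec_opened x s L M : state_spec s L ->
  (forall c, c \in unzip1 M <-> c \in unzip1 L /\ (forall b, x = b.+1 -> c <> b /\
     (c < b -> forall i j, succ_arc s i j -> ~~ ((i < c) && (b < j))))) ->
  (forall c t, (c, t) \in M -> (exists2 b, x = b.+1 & c < b) /\ t = 0 \/
     (forall b, x = b.+1 -> b <= c) /\ (c, t) \in L) ->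
  state_spec (x :: s) (opened M).
Proof.
move=> [sp1 sp2] H1 H2; split=> [c|c t y].
  rewrite /opened /= in_cons; case: c => [|c] /=.
    split=> // _; split=> // [i|i1 i2 j1 j2 _ _]; last by rewrite andbF.
    by apply/negP => /succ_arc_ltn.
  rewrite usable_cons -sp1 -H1.
  rewrite /unzip1 -map_comp (map_comp S fst) mem_map //; exact: succn_inj.
rewrite in_cons => /predU1P[[-> _] //|/mapP[[c' t'] /= /H2 ct' [-> ->]]].
case: y => [|y]; first by split.
rewrite !ltnS => yc; case: ct' => [[[b xb cb] ->]|[bc ct]].
  split=> // /(_ 0 b.+1); rewrite xb /= eqxx !ltnS => /(_ isT).
  by rewrite cb.
rewrite (sp2 _ _ _ ct yc); split=> H i j.
  case/succ_arc_cons=> [[-> [b xb ->]]|[i' [j' [-> -> /H]]]]; last by rewrite !ltnS.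
  by have := bc b xb; rewrite !ltnS; lia.
by move=> a; have := H i.+1 j.+1 a; rewrite !ltnS.
Qed.

Lemma mem_closed_at L b t c u : (c, u) \in closed_at L b t <->
  (c < minn b t) || (b < c) /\ if c < b then u = 0 /\ c \in unzip1 L else (c, u) \in L.
Proof.
split.
  case/mapP=> -[c' u']; rewrite mem_filter /= => /andP[H cL] [-> ->]; split=> //.
  by case: (c' < b) => //; split=> //; apply/mapP; exists (c', u').
case=> H; case: ifP => cb.
  case=> -> /mapP[[c' u'] cL /= e]; rewrite {c}e in H cb *.
  by apply/mapP; exists (c', u'); rewrite /= ?cb // mem_filter /= H.
by move=> cL; apply/mapP; exists (c, u); rewrite /= ?cb // mem_filter /= H.
Qed.

Lemma mem_state_nth (L : seq (nat * nat)) (b : nat) : b \in unzip1 L ->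
  (b, nth 0 (unzip2 L) (index b (unzip1 L))) \in L.
Proof.
move=> bL; have := bL; rewrite -index_mem size_map => iL.
have -> : (b, nth 0 (unzip2 L) (index b (unzip1 L))) = nth (0, 0) L (index b (unzip1 L)).
  rewrite (nth_map (0, 0)) // [RHS]surjective_pairing; congr (_, _).
  by rewrite -(nth_map _ 0) // nth_index.
exact: mem_nth.
Qed.

Lemma legalP s : legal s -> state_spec s (state s) /\ good_state (state s).
Proof.
elim: s => [_|x s IH]; first by split=> //; split=> // b; split=> // -[].
rewrite [legal _]/= => /andP[/IH[sp gs] xs].
case: x xs => [|b] xs.
  split; last exact: good_opened.
  apply: (state_spec_opened _ _ _ _ sp) => [c|c t ct]; first by split=> // -[].
  by right.
have bs := mem_state_nth _ _ xs.
rewrite [state _]/=; set t := nth _ _ _ in bs *.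
split; last by apply: good_opened; apply: (good_closed_at _ (b, t)).
have [sp1 sp2] := sp.
apply: (state_spec_opened _ _ _ _ sp) => [c|c u /mem_closed_at[H]].
  split.
    case/mapP=> -[c' u] /mem_closed_at[H Hu] /= ->.
    have cL : c' \in unzip1 (state s).
      by move: Hu; case: ifP => [_ []|_ cu] //; apply/mapP; exists (c', u).
    split=> // b' [<-]; split; first by move=> e; move: H; rewrite e ltn_min ltnn.
    by move=> cb; apply/(sp2 b t c' bs cb); move: H; rewrite ltn_min; lia.
  case=> /mapP[[c' u] cL /= ec] /(_ b erefl)[cb Hb].
  apply/mapP; exists (c, if c < b then 0 else u) => //; apply/mem_closed_at; split.
    have [/[dup] cb' /Hb/(sp2 b t c bs cb')|] := ltnP c b; first by rewrite ltn_min cb' => ->.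
    by rewrite leq_eqVlt => /predU1P[/esym//|->]; rewrite orbT.
  by case: (c < b); [split=> //|]; rewrite ec //; apply: map_f cL.
case: ifP => [cb [-> _]|cb cu]; first by left; split=> //; exists b.
by right; split=> // b' [<-]; rewrite leqNgt cb.
Qed.

(** In a 3-crossing through the new vertex its arc comes first, so the other two arcs form a
    2-crossing with b in the middle. *)
Lemma targets_cons x s : targets_ok (x :: s) /\ no_3crossing (x :: s) <->
  (targets_ok s /\ no_3crossing s) /\ forall b, x = b.+1 -> usable s b.
Proof.
split=> [[[T1 T2] X]|[[[T1 T2] X] U]].
  split=> [|b xb].
    split; first split=> [i j|i i' j a a'].
    - exact: (T1 i.+1 j.+1).
    - by have [] := T2 i.+1 i'.+1 j.+1 a a'.
    move=> i1 i2 i3 j1 j2 j3 a1 a2 a3.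
    by have := X i1.+1 i2.+1 i3.+1 j1.+1 j2.+1 j3.+1 a1 a2 a3; rewrite !ltnS.
  have a0 : succ_arc (x :: s) 0 b.+1 by rewrite xb /= eqxx.
  split=> [|i|i1 i2 j1 j2 a1 a2]; first exact: T1 a0.
    by apply/negP => /(T2 0 i.+1 b.+1 a0).
  have := X 0 i1.+1 i2.+1 b.+1 j1.+1 j2.+1 a0 a1 a2.
  by rewrite !ltnS.
split; first split=> [i j|i i' j].
- case/succ_arc_cons=> [[_ [b /U[bs _ _] ->]]|[i' [j' [_ ->]]]] //.
  exact: T1.
- case/succ_arc_cons=> [[-> [b /U[_ bn _] ->]]|[k [l [-> -> a]]]];
    case/succ_arc_cons=> [[-> [c xc e]]|[k' [l' [-> e a']]]] //.
  + by case: e a' (bn k') => -> ->.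
  + by have [_ /(_ k)] := U c xc; case: e => <-; rewrite a.
  + by case: e a' => <- a'; rewrite (T2 _ _ _ a a').
move=> i1 i2 i3 j1 j2 j3.
case/succ_arc_cons=> [[-> [b xb ->]]|[i1' [j1' [-> -> a1]]]];
 case/succ_arc_cons=> [[-> _]|[i2' [j2' [-> -> a2]]]];
 case/succ_arc_cons=> [[-> _]|[i3' [j3' [-> -> a3]]]]; rewrite ?ltn0 ?andbF //.
  have [_ _ /(_ i2' i3' j2' j3' a2 a3)] := U b xb.
  by rewrite !ltnS.
by rewrite !ltnS; apply: X.
Qed.

Lemma legal_targets s : legal s <-> targets_ok s /\ no_3crossing s.
Proof.
elim: s => [|x s IH]; first by split=> // _; split=> //; split.
rewrite targets_cons -IH; split.
  rewrite [legal _]/= => /andP[ls xs]; split=> // b xb.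
  have [[sp _] _] := legalP _ ls; apply/sp; by move: xs; rewrite xb.
rewrite [legal (_ :: _)]/= => -[ls U]; rewrite ls; case: x U => // b /(_ b erefl) U /=.
by have [[sp _] _] := legalP _ ls; apply/sp.
Qed.

Fixpoint legal_seqs (n : nat) : seq (seq nat) :=
  if n is n'.+1 then
    flatten [seq [seq x :: s | x <- 0 :: map S (unzip1 (state s))] | s <- legal_seqs n']
  else [:: [::]].

Lemma mem_legal_seqs n s : (s \in legal_seqs n) = (size s == n) && legal s.
Proof.
elim: n s => [|n IH] s; first by case: s.
apply/flatten_mapP/andP => [[s']|].
  rewrite IH => /andP[/eqP<- ls'] /mapP[x].
  rewrite in_cons => /predU1P[->|/mapP[b bs ->]] -> /=; first by rewrite eqxx ls'.
  by rewrite eqxx ls' bs.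
case: s => [[]|x s] //= [sn /andP[ls xs]]; exists s; first by rewrite IH -eqSS sn.
case: x xs => [|b] bs; first by rewrite in_cons eqxx.
rewrite in_cons; apply/orP; right; apply/mapP; exists b.+1 => //.
by rewrite mem_map //; exact: succn_inj.
Qed.

Lemma uniq_legal_seqs n : uniq (legal_seqs n).
Proof.
elim: n => //= n IH.
rewrite (_ : flatten _ = [seq x :: s | s <- legal_seqs n, x <- 0 :: map S (unzip1 (state s))]) //.
apply: allpairs_uniq_dep => // [s|[s x] [s' x'] _ _ /= [-> ->]] //.
rewrite mem_legal_seqs => /andP[_ /legalP[_ /andP[us _]]].
rewrite /= map_inj_uniq; last exact: succn_inj.
rewrite (sorted_uniq ltn_trans ltnn us) andbT.
by apply/mapP => -[].
Qed.

Lemma state_consE s q : legal s -> q \in state s ->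
  state (q.1.+1 :: s) = opened (closed_at (state s) q.1 q.2).
Proof.
move=> /legalP[_ /andP[us _]]; case: q => b t bs; rewrite [LHS]/=.
suff -> : nth 0 (unzip2 (state s)) (index b (unzip1 (state s))) = t by [].
have ub : uniq (unzip1 (state s)) by apply: (sorted_uniq ltn_trans ltnn us).
case: (splitPr bs) ub => p r; rewrite /unzip1 /unzip2 !map_cat /= cat_uniq.
case/and3P=> _ + _; rewrite /= negb_or => /andP[bp _].
by rewrite index_cat (negPf bp) /= eqxx addn0 nth_cat !size_map ltnn subnn.
Qed.

(** Legal sequences of length m + n are sorted by their final m entries. *)
Lemma sum_nb_desc n m :
  \sum_(s <- legal_seqs m) nb_desc n (state s) = size (legal_seqs (m + n)).
Proof.
elim: n m => [|n IH] m; first by rewrite addn0 sum1_size.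
rewrite addnS -addSn -IH /= big_flatten big_map.
apply: eq_big_seq => s; rewrite mem_legal_seqs => /andP[_ ls].
rewrite big_cons !big_map /=; congr (_ + _).
by apply: eq_big_seq => q qs; rewrite -state_consE.
Qed.

Lemma size_legal_seqs n : size (legal_seqs n) = walks n 0 0.
Proof.
by rewrite -(sum_nb_desc n 0) big_seq1 nb_desc_walks.
Qed.

(** * Set partitions *)

Lemma eq_preim_partition (T : finType) (rT rT' : eqType) (f : T -> rT) (f' : T -> rT') D :
  (forall x y, (f x == f y) = (f' x == f' y)) -> preim_partition f D = preim_partition f' D.
Proof.
by move=> e; apply: eq_imset => x; apply/setP => y; rewrite !inE e.
Qed.

Lemma pblock_preim_partition (T : finType) (rT : eqType) (f : T -> rT) (x y : T) :
  (pblock (preim_partition f [set: T]) x == pblock (preim_partition f [set: T]) y)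
  = (f x == f y).
Proof.
have [/eqP cov tiP _] := and3P (preim_partitionP f [set: T]).
rewrite eq_pblock ?cov ?inE //.
by rewrite (@pblock_equivalence_partition _ (fun x y => f x == f y)) ?inE //
  => a b c *; split=> // /eqP->.
Qed.

Lemma arcE n (P : {set {set 'I_n}}) (i j : 'I_n) : partition P [set: 'I_n] ->
  Defs.arc P (i, j) = [&& i < j, pblock P i == pblock P j
                   & [forall l : 'I_n, (i < l < j) ==> (pblock P i != pblock P l)]].
Proof.
case/and3P=> /eqP cov tiP _; rewrite /Defs.arc /=; congr (_ && _).
have icov x : x \in cover P by rewrite cov inE.
apply/existsP/andP => [[B /and4P[PB iB jB /forallP H]]|[/eqP ij /forallP H]].
  rewrite !(def_pblock tiP PB) //; split=> //; apply/forallP => l; apply/implyP => il.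
  apply: contraTneq il => e; move/implyP: (H l); apply.
  by rewrite e mem_pblock.
exists (pblock P i); rewrite pblock_mem // mem_pblock icov /= ij mem_pblock icov /=.
apply/forallP => l; apply/implyP => lP; apply/negP => il.
by move/implyP: (H l) => /(_ il) /negP; apply; rewrite eq_pblock // ij.
Qed.

Lemma arc_inj n (P : {set {set 'I_n}}) (i i' j : 'I_n) : partition P [set: 'I_n] ->
  Defs.arc P (i, j) -> Defs.arc P (i', j) -> i = i'.
Proof.
move=> pP; rewrite !arcE // => /and3P[ij /eqP bij /forallP H] /and3P[ij' /eqP bij' /forallP H'].
apply: val_inj; case: (ltngtP i i') => [l|l|//].
  by move: (H i'); rewrite l ij' bij bij' eqxx.
by move: (H' i); rewrite l ij bij bij' eqxx.
Qed.

Lemma arc_fun n (P : {set {set 'I_n}}) (i j j' : 'I_n) : partition P [set: 'I_n] ->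
  Defs.arc P (i, j) -> Defs.arc P (i, j') -> j = j'.
Proof.
move=> pP; rewrite !arcE // => /and3P[ij /eqP bij /forallP H] /and3P[ij' /eqP bij' /forallP H'].
apply: val_inj; case: (ltngtP j j') => [l|l|//].
  by move: (H' j); rewrite l ij bij eqxx.
by move: (H j'); rewrite l ij' bij' eqxx.
Qed.

Definition code n (P : {set {set 'I_n}}) : seq nat :=
  [seq (if [pick j | Defs.arc P (i, j)] is Some j then j - i else 0) | i <- enum 'I_n].

Lemma size_code n (P : {set {set 'I_n}}) : size (code n P) = n.
Proof. by rewrite size_map -cardE card_ord. Qed.

Lemma nth_code n (P : {set {set 'I_n}}) (i : 'I_n) :
  nth 0 (code n P) i = if [pick j | Defs.arc P (i, j)] is Some j then j - i else 0.
Proof. by rewrite (nth_map i) ?nth_ord_enum // -cardE card_ord. Qed.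

Lemma succ_arc_code n (P : {set {set 'I_n}}) (i j : 'I_n) : partition P [set: 'I_n] ->
  succ_arc (code n P) i j = Defs.arc P (i, j).
Proof.
move=> pP; rewrite succ_arcE size_code ltn_ord nth_code /=.
case: pickP => [k ik|/(_ j) -> //]; have ltk : i < k by case/andP: ik.
rewrite subn_gt0 ltk subnKC ?(ltnW ltk) //=.
apply/eqP/idP => [/val_inj-> //|ij]; congr val; exact: arc_fun ij ik.
Qed.

Lemma succ_arc_codeP n (P : {set {set 'I_n}}) i j : partition P [set: 'I_n] ->
  succ_arc (code n P) i j -> exists i' j' : 'I_n, [/\ i = i', j = j' & Defs.arc P (i', j')].
Proof.
move=> pP a; have := a; rewrite succ_arcE size_code => /and3P[ni ki /eqP ej].
have nj : j < n.
  move: ki ej; rewrite (nth_code n P (Ordinal ni)); case: pickP => //= k.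
  by case/andP=> ik _ _ ->; rewrite subnKC // ltnW.
by exists (Ordinal ni), (Ordinal nj); rewrite -succ_arc_code.
Qed.

Lemma targets_code n (P : {set {set 'I_n}}) : partition P [set: 'I_n] -> targets_ok (code n P).
Proof.
move=> pP; split=> [i j|i i' j].
  by case/succ_arc_codeP=> // i' [j' [_ -> _]]; rewrite size_code.
case/succ_arc_codeP=> // k [l [-> -> kl]] /succ_arc_codeP[] // k' [l' [-> /val_inj e kl']].
by rewrite (arc_inj n P k k' l) // e.
Qed.

Lemma noncrossing_code n (P : {set {set 'I_n}}) : partition P [set: 'I_n] ->
  noncrossing 3 P <-> no_3crossing (code n P).
Proof.
move=> pP; split=> [/forallP H i1 i2 i3 j1 j2 j3|H].
  case/succ_arc_codeP=> // a1 [b1 [-> -> ab1]].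
  case/succ_arc_codeP=> // a2 [b2 [-> -> ab2]].
  case/succ_arc_codeP=> // a3 [b3 [-> -> ab3]].
  have := H [tuple (a1, b1); (a2, b2); (a3, b3)].
  by rewrite /crossing /= ab1 ab2 ab3 /= !andbT.
apply/forallP => e; apply/negP => /andP[].
case/tupleP: e => -[a1 b1] e; case/tupleP: e => -[a2 b2] e; case/tupleP: e => -[a3 b3] e.
rewrite tuple0 /= !andbT => /and3P[ab1 ab2 ab3].
by apply/negP; apply: H; rewrite succ_arc_code.
Qed.

(** The end of the chain of arcs from i, which serves as the label of its block. *)
Fixpoint last_of (s : seq nat) (i : nat) : nat :=
  match s, i with
  | [::], _ => i
  | x :: s', 0 => if x is b.+1 then (last_of s' b).+1 else 0
  | _ :: s', i'.+1 => (last_of s' i').+1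
  end.

Lemma last_of_arc s i j : succ_arc s i j -> last_of s i = last_of s j.
Proof.
elim: s i j => [|x s IH] // [|i] [|j] //=; [by case: x => //= x /eqP[->]|].
by move/IH->.
Qed.

Lemma targets_behead x s : targets_ok (x :: s) -> targets_ok s.
Proof.
case=> T1 T2; split=> [i j|i i' j a a']; first exact: (T1 i.+1 j.+1).
by have [] := T2 i.+1 i'.+1 j.+1 a a'.
Qed.

(* Two chains of arcs with the same endpoint are nested, as arcs have distinct
   right endpoints. *)
Lemma last_of_eq s i j : targets_ok s -> i < j -> last_of s i = last_of s j ->
  exists2 k, succ_arc s i k & k <= j.
Proof.
elim: s i j => [|x s IH] i j Ts ij e; first by move: e ij => /= ->; rewrite ltnn.
have IHs := IH _ _ (targets_behead _ _ Ts).
case: i j ij e => [|i] [|j] //=; last first.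
  by rewrite ltnS => ij [/(IHs _ _ ij)[k ik kj]]; exists k.+1.
case: x Ts => // b Ts _ [e].
have [bj|jb] := leqP b j; first by exists b.+1; rewrite /= ?eqxx.
(* Otherwise the first arc jumps over j. The chain from j then enters b by a second arc, against the
   distinctness of right endpoints. *)
have [k] : exists2 k, succ_arc s k b & j <= k; last first.
  by move=> kb _; have := Ts.2 0 k.+1 b.+1; rewrite /= eqxx => /(_ isT kb).
move: {2}(b - j) (leqnn (b - j)) => d; elim: d j jb e => [|d IHd] j jb e bd; first lia.
have [k jk] := IHs _ _ jb (esym e); rewrite leq_eqVlt => /predU1P[kb|kb].
  by exists j => //; rewrite -kb.
have jk' := succ_arc_ltn jk.
have [||k' k'b kk'] := IHd k kb; rewrite -?(last_of_arc _ _ _ jk) //; first lia.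
by exists k' => //; apply: leq_trans (ltnW _) kk'.
Qed.

Definition decode n (s : seq nat) : {set {set 'I_n}} :=
  preim_partition (fun i : 'I_n => last_of s i) [set: 'I_n].

Lemma decodeP n s : partition (decode n s) [set: 'I_n].
Proof. exact: preim_partitionP. Qed.

Lemma arc_decode n s (i j : 'I_n) : size s = n -> targets_ok s ->
  Defs.arc (decode n s) (i, j) = succ_arc s i j.
Proof.
move=> sn Ts; rewrite arcE ?decodeP // pblock_preim_partition.
apply/and3P/idP => [[ij /eqP e /forallP H]|a].
  have [k ik] := last_of_eq _ _ _ Ts ij e; rewrite leq_eqVlt => /predU1P[<- //|kj].
  have kn : k < n by rewrite -sn (Ts.1 _ _ ik).
  move: (H (Ordinal kn)); rewrite pblock_preim_partition /= kj (succ_arc_ltn ik) /=.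
  by rewrite (last_of_arc _ _ _ ik) eqxx.
have ij := succ_arc_ltn a; split=> //; first by rewrite (last_of_arc _ _ _ a).
apply/forallP => l; rewrite pblock_preim_partition.
apply/implyP => /andP[il lj]; apply/eqP => /(last_of_eq _ _ _ Ts il)[k ik kl].
by move: kl; rewrite (succ_arc_fun ik a) leqNgt lj.
Qed.

Lemma decodeK n s : size s = n -> targets_ok s -> code n (decode n s) = s.
Proof.
move=> sn Ts; apply: (@eq_from_nth _ 0) => [|i]; rewrite size_code ?sn // => ni.
have si : forall j, succ_arc (code n (decode n s)) i j = succ_arc s i j.
  move=> j; have [nj|nj] := ltnP j n.
    by rewrite (succ_arc_code n _ (Ordinal ni) (Ordinal nj)) ?decodeP // arc_decode.
  apply/idP/idP => [/(targets_code _ _ (decodeP n s)).1|/Ts.1].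
    by rewrite size_code ltnNge nj.
  by rewrite sn ltnNge nj.
have := si (i + nth 0 s i); have := si (i + nth 0 (code n (decode n s)) i).
rewrite !succ_arcE sn size_code ni /= !eqn_add2l.
by case: (nth 0 s i) => [|a]; case: (nth 0 (code _ _) i) => [|b] //=; rewrite eqxx // => /esym/eqP.
Qed.

Lemma codeK n (P : {set {set 'I_n}}) : partition P [set: 'I_n] -> decode n (code n P) = P.
Proof.
move=> pP; rewrite -[RHS](preim_partition_pblock pP); apply: eq_preim_partition => i j.
have step (k l : 'I_n) : Defs.arc P (k, l) ->
    last_of (code n P) k = last_of (code n P) l /\ pblock P k = pblock P l.
  move=> a; split; first by apply: last_of_arc; rewrite succ_arc_code.
  by move: a; rewrite arcE // => /and3P[_ /eqP].
wlog ij : i j / i <= j.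
  by move=> H; case/orP: (leq_total i j) => /H // e; rewrite eq_sym e eq_sym.
move: {2}(j - i) (leqnn (j - i)) => d; elim: d i ij => [|d IHd] i ij dij.
  have -> : i = j by apply/val_inj/eqP; rewrite eqn_leq ij /=; lia.
  by rewrite !eqxx.
move: ij; rewrite leq_eqVlt => /predU1P[/val_inj->|ij]; first by rewrite !eqxx.
apply/eqP/eqP => e.
  have [k ik kj] := last_of_eq _ _ _ (targets_code _ _ pP) ij e.
  have [i' [k' [/val_inj ei ek a]]] := succ_arc_codeP _ _ _ _ pP ik.
  rewrite -{i'}ei {k}ek in ik a kj *.
  have ik' := succ_arc_ltn ik; have [e1 e2] := step _ _ a.
  by rewrite e2; apply/eqP; rewrite -IHd -?e1 ?e //; lia.
(* The least such k is the successor of i in its block. *)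
pose Q (k : 'I_n) := (i < k) && (pblock P i == pblock P k).
have Qj : Q j by rewrite /Q ij e eqxx.
case: (arg_minnP (fun k : 'I_n => k : nat) Qj) => k /andP[ik /eqP bk] kmin.
have a : Defs.arc P (i, k).
  rewrite arcE // ik bk eqxx /=; apply/forallP => l; apply/implyP => /andP[il lk].
  apply: contraTneq lk => bl; rewrite -leqNgt; apply: kmin; by rewrite /Q il bk bl eqxx.
have [e1 e2] := step _ _ a; have kj := kmin _ Qj.
by rewrite e1; apply/eqP; rewrite IHd -?e2 ?e //; lia.
Qed.

Theorem num_noncrossing_walks n : num_noncrossing 3 n = walks n 0 0.
Proof.
rewrite -size_legal_seqs /num_noncrossing cardE.
rewrite -(size_map (code n)); apply: perm_size; apply: uniq_perm => [||s].
- rewrite map_inj_in_uniq ?enum_uniq // => P P'; rewrite !mem_enum !inE.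
  by move=> /andP[pP _] /andP[pP' _] e; rewrite -(codeK n P) // e codeK.
- exact: uniq_legal_seqs.
rewrite mem_legal_seqs; apply/mapP/andP => [[P]|[/eqP sn ls]].
  rewrite mem_enum inE => /andP[pP ncP] ->; rewrite size_code eqxx; split=> //.
  by apply/legal_targets; split; [apply: targets_code | apply/noncrossing_code].
have [Ts X] := (legal_targets s).1 ls.
exists (decode n s); last by rewrite decodeK.
rewrite mem_enum inE decodeP; apply/noncrossing_code; first exact: decodeP.
by rewrite decodeK.
Qed.

Local Open Scope ring_scope.

(** * The reflection principle *)

(** On coefficients of x^a y^b this is multiplication by 1 + x + y, and [hstep] is that by 1 + 1/x +
    1/y. *)
Definition vstep (f : int -> int -> rat) (a b : int) : rat := f a b + f (a - 1) b + f a (b - 1).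
Definition hstep (f : int -> int -> rat) (a b : int) : rat := f a b + f (a + 1) b + f a (b + 1).
Definition step (f : int -> int -> rat) : int -> int -> rat := hstep (vstep f).

(* The two reflections generating the dihedral group of order 12; their mirrors
   are the lines [a - b = -1] and [b = -1] that bound the chamber. *)
Definition alternating (f : int -> int -> rat) :=
  (forall a b, f (b - 1) (a + 1) = - f a b) /\ (forall a b, f (a + b + 1) (- b - 2) = - f a b).

Lemma eq_step f f' : (forall a b, f a b = f' a b) -> forall a b, step f a b = step f' a b.
Proof. by move=> e a b; rewrite /step /hstep /vstep !e. Qed.

Lemma stepE f a b : step f a b = f a b *+ 3 + (f (a + 1) b + f (a - 1) b
  + f a (b + 1) + f a (b - 1) + f (a + 1) (b - 1) + f (a - 1) (b + 1)).
Proof. by rewrite /step /hstep /vstep !addrK; ring. Qed.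

Lemma alternating_step f : alternating f -> alternating (step f).
Proof.
case=> A1 A2; split=> a b; rewrite !stepE.
- rewrite A1.
  rewrite (_ : f (b - 1) ((a + 1) + 1) = - f (a + 1) b); last by rewrite -A1; congr (f _ _); ring.
  rewrite (_ : f (b - 1) ((a + 1) - 1) = - f (a - 1) b); last by rewrite -A1; congr (f _ _); ring.
  rewrite (_ : f ((b - 1) + 1) (a + 1) = - f a (b + 1)); last by rewrite -A1; congr (f _ _); ring.
  rewrite (_ : f ((b - 1) - 1) (a + 1) = - f a (b - 1)); last by rewrite -A1; congr (f _ _); ring.
  rewrite (_ : f ((b - 1) - 1) ((a + 1) + 1) = - f (a + 1) (b - 1));
    last by rewrite -A1; congr (f _ _); ring.
  rewrite (_ : f ((b - 1) + 1) ((a + 1) - 1) = - f (a - 1) (b + 1));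
    last by rewrite -A1; congr (f _ _); ring.
  ring.
- rewrite A2.
  rewrite (_ : f ((a + b + 1) + 1) (- b - 2) = - f (a + 1) b);
    last by rewrite -A2; congr (f _ _); ring.
  rewrite (_ : f ((a + b + 1) - 1) (- b - 2) = - f (a - 1) b);
    last by rewrite -A2; congr (f _ _); ring.
  rewrite (_ : f ((a + b + 1) + 1) ((- b - 2) - 1) = - f a (b + 1));
    last by rewrite -A2; congr (f _ _); ring.
  rewrite (_ : f ((a + b + 1) - 1) ((- b - 2) + 1) = - f a (b - 1));
    last by rewrite -A2; congr (f _ _); ring.
  rewrite (_ : f (a + b + 1) ((- b - 2) + 1) = - f (a + 1) (b - 1));
    last by rewrite -A2; congr (f _ _); ring.
  rewrite (_ : f (a + b + 1) ((- b - 2) - 1) = - f (a - 1) (b + 1));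
    last by rewrite -A2; congr (f _ _); ring.
  ring.
Qed.

Definition plane_walks (f0 : int -> int -> rat) (n : nat) := iter n step f0.

Lemma alternating_plane_walks f0 n : alternating f0 -> alternating (plane_walks f0 n).
Proof. by move=> A; elim: n => //= n; apply: alternating_step. Qed.

Lemma wall1 f a : alternating f -> f a (a + 1) = 0.
Proof.
case=> A1 _; have := A1 a (a + 1); rewrite addrK => e.
lra.
Qed.

Lemma wall2 f a : alternating f -> f a (-1) = 0.
Proof.
case=> _ A2; have := A2 a (-1); rewrite addrNK (_ : - - 1 - 2 = - 1) // => e.
lra.
Qed.

(** The rows are a = h + b and b. A forbidden removal ends on a mirror, where the function vanishes;
    a forbidden addition meets a zero of [vstep]. *)
Lemma chamber_walks f0 n : alternating f0 ->
  (forall h b : nat, f0 (h + b)%N b = ((h == 0%N) && (b == 0%N))%:R) ->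
  forall h b : nat, (stay up (walks n) h b)%:R = plane_walks f0 n (h + b)%N b.
Proof.
move=> A0 f00; elim: n => [|n IH] h b.
  rewrite /plane_walks [iter _ _ _]/= f00 /stay /up /=.
  case: h => [|h] /=; rewrite ?addn0 ?add0n //.
  by rewrite andbF.
have A := alternating_plane_walks f0 n A0.
rewrite [walks _]/= [plane_walks _ _]/= -/(plane_walks f0 n).
move: (stay up (walks n)) IH => G IH; set K := stay down G.
have down_eq (h' b' : nat) :
    (K h' b')%:R = vstep (plane_walks f0 n) (h' + b')%N b'.
  rewrite /K /stay /down /vstep !natrD. rewrite IH; rewrite -addrA; congr (_ + _).
  have -> : (h' + b')%N%:Z - 1 = (h'%:Z + b'%:Z - 1) :> int by lia.
  case: h' => [|h'].
    have := wall1 (plane_walks f0 n) (b'%:Z - 1) A; rewrite subrK.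
    have -> : 0%:Z + b'%:Z - 1 = b'%:Z - 1 by lia.
    move=> ->; rewrite !add0r add0n; case: b' => [|b'].
      by rewrite (wall2 _ _ A).
    by rewrite IH; congr (plane_walks f0 n _ _); lia.
  rewrite IH; have -> : h'.+1%:Z + b'%:Z - 1 = (h' + b')%N by lia.
  congr (_ + _); case: b' => [|b']; first by rewrite (wall2 _ _ A).
  by rewrite IH; congr (plane_walks f0 n _ _); lia.
rewrite /stay natrD /up natrD !down_eq /step /hstep -[RHS]addrA; congr GRing.add.
have -> : (h + b)%N%:Z + 1 = (h.+1 + b)%N by lia.
congr GRing.add; case: h => [|h]; last first.
  by rewrite down_eq; congr (vstep (plane_walks f0 n) _ _); lia.
(* At (b, b + 1), on a mirror, [vstep] has one term on that mirror and two that are mirror images of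
   each other and cancel. *)
rewrite /vstep add0n addrK; have := wall1 (plane_walks f0 n) b A.
have := A.1 b b; rewrite (_ : b%:Z + 1 = b.+1) //; last by lia.
by move=> -> ->; rewrite add0r addNr.
Qed.

(** * Coefficients of powers of (1 + x + y)(1 + 1/x + 1/y) *)

(** The value 0 at negative integers makes 1/(z-1)! = z/z! hold for every integer z. *)
Definition ifact (z : int) : rat := if z is Posz k then (k`!)%:R^-1 else 0.
Definition zfact (z : int) : rat := (`|z|%N`!)%:R.

Lemma ifact_pred z : ifact (z - 1) = z%:~R * ifact z.
Proof.
case: z => [[|k]|k] //.
  have -> : k.+1%:Z - 1 = k by lia.
  rewrite /= factS natrM invfM mulrA mulfV ?mul1r //.
  by rewrite pnatr_eq0.
have -> : Negz k - 1 = Negz k.+1 by lia.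
by rewrite mulr0.
Qed.

Lemma ifactN z : z < 0 -> ifact z = 0.
Proof. by case: z. Qed.

Lemma zfact_pred z : 0 < z -> zfact z = z%:~R * zfact (z - 1).
Proof.
case: z => [[|k]|k] // _; have -> : k.+1%:Z - 1 = k by lia.
by rewrite /zfact /= factS natrM.
Qed.

(* [lattice_term n m i j l] is the contribution of the pairs of factors to the
   coefficient of x^i y^j in (1 + x + y)^n (1 + 1/x + 1/y)^m that use 1/x or 1/y
   exactly [l] times: binom(m,l) binom(n,l+i+j) binom(2l+i+j,l+i). *)
Definition lattice_term (n m : nat) (i j l : int) : rat :=
  n`!%:R * m`!%:R * zfact (l + l + i + j) * ifact l * ifact (l + i + j)
  * ifact (l + i) * ifact (l + j) * ifact (m%:Z - l) * ifact (n%:Z - l - i - j).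

Definition lattice (n m : nat) (i j : int) : rat :=
  \sum_(0 <= l < m.+1) lattice_term n m i j l.

Lemma lattice_term_neg n m i j l : l < 0 -> lattice_term n m i j l = 0.
Proof. by move=> l0; rewrite /lattice_term (ifactN l) // !(mulr0, mul0r). Qed.

Lemma lattice_term_big n m i j l : m%:Z < l -> lattice_term n m i j l = 0.
Proof.
by move=> l0; rewrite /lattice_term (ifactN (_ - l)) ?subr_lt0 // !(mulr0, mul0r).
Qed.

(** Pascal's rule: with s = l + i + j and T = 2l + i + j, it reads (n+1) T = (n+1-s) T + s (l+i) + s
    (l+j). *)
Lemma lattice_vterm n m i j (l : int) : 0 <= l ->
  lattice_term n.+1 m i j l
  = lattice_term n m i j l + lattice_term n m (i - 1) j l + lattice_term n m i (j - 1) l.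
Proof.
move=> l0; rewrite /lattice_term factS natrM.
have [s0|s0] := ltrP (l + i + j) 0.
  by rewrite !(ifactN (l + _ + _)) ?(mulr0, mul0r, addr0) //; lia.
have -> : n.+1%:Z - l - i - j = n%:Z - l - i - j + 1 by lia.
set w := n%:Z - l - i - j.
have -> : n%:Z - l - (i - 1) - j = w + 1 by rewrite /w; lia.
have -> : n%:Z - l - i - (j - 1) = w + 1 by rewrite /w; lia.
have ew : ifact w = (w + 1)%:~R * ifact (w + 1) by rewrite -ifact_pred addrK.
have -> : l + l + (i - 1) + j = l + l + i + j - 1 by lia.
have -> : l + l + i + (j - 1) = l + l + i + j - 1 by lia.
have -> : l + (i - 1) + j = l + i + j - 1 by lia.
have -> : l + i + (j - 1) = l + i + j - 1 by lia.
have -> : l + (i - 1) = l + i - 1 by lia.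
have -> : l + (j - 1) = l + j - 1 by lia.
rewrite !ifact_pred ew.
have [t0|t0] := ltrP 0 (l + l + i + j).
  rewrite (zfact_pred _ t0) /w !(rmorphD, rmorphN, rmorph1) /=.
  by rewrite -[n.+1%:R]/(n.+1%:~R) -addn1 PoszD rmorphD /=; ring.
(* The recurrence of [zfact] stops at 0; here T = 0 forces s = 0. *)
have e : l + i + j = 0 by lia.
rewrite e mul0r !(mulr0, mul0r, addr0) /w.
have -> : n%:Z - l - i - j + 1 = n.+1%:Z by lia.
by rewrite -[n.+1%:R]/(n.+1%:~R); ring.
Qed.

Lemma lattice_hterm n m i j (l : int) :
  lattice_term n m.+1 i j l = lattice_term n m i j l
    + lattice_term n m (i + 1) j (l - 1) + lattice_term n m i (j + 1) (l - 1).
Proof.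
rewrite /lattice_term factS natrM.
have [l0|l0] := ltrP l 0.
  by rewrite !(ifactN l) ?(ifactN (l - 1)) ?(mulr0, mul0r, addr0) //; lia.
have [s0|s0] := ltrP (l + i + j) 0.
  rewrite (ifactN (l + i + j)) ?(ifactN (l - 1 + (i + 1) + j)) ?(ifactN (l - 1 + i + (j + 1)));
    by [rewrite !(mulr0, mul0r, addr0)|lia].
have -> : m.+1%:Z - l = m%:Z - l + 1 by lia.
have -> : m%:Z - (l - 1) = m%:Z - l + 1 by lia.
have ew : ifact (m%:Z - l) = (m%:Z - l + 1)%:~R * ifact (m%:Z - l + 1).
  by rewrite -ifact_pred addrK.
have -> : n%:Z - (l - 1) - (i + 1) - j = n%:Z - l - i - j by lia.
have -> : n%:Z - (l - 1) - i - (j + 1) = n%:Z - l - i - j by lia.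
have -> : l - 1 + (l - 1) + (i + 1) + j = l + l + i + j - 1 by lia.
have -> : l - 1 + (l - 1) + i + (j + 1) = l + l + i + j - 1 by lia.
have -> : l - 1 + (i + 1) = l + i by lia.
have -> : l - 1 + (j + 1) = l + j by lia.
have -> : l - 1 + j = l + j - 1 by lia.
have -> : l - 1 + i = l + i - 1 by lia.
have -> : l + i - 1 + (j + 1) = l + i + j by lia.
rewrite !ifact_pred ew.
have em : (m.+1)%:R = m%:~R + 1 :> rat by rewrite -addn1 natrD.
have [t0|t0] := ltrP 0 (l + l + i + j).
  by rewrite (zfact_pred _ t0) em !(rmorphD, rmorphN, rmorph1) /=; ring.
have e : l = 0 by lia.
by rewrite e mul0r !(mulr0, mul0r, addr0) em !(rmorphD, rmorphN, rmorph1, rmorph0) /=; ring.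
Qed.

Lemma lattice_vstep n m i j : lattice n.+1 m i j = vstep (lattice n m) i j.
Proof.
rewrite /vstep /lattice -!big_split /=; apply: eq_bigr => l _.
exact: lattice_vterm.
Qed.

Lemma lattice_hstep n m i j : lattice n m.+1 i j = hstep (lattice n m) i j.
Proof.
rewrite /lattice /hstep; under eq_bigr => l _ do rewrite lattice_hterm.
rewrite !big_split /=; congr (_ + _ + _).
- by rewrite big_nat_recr //= lattice_term_big ?addr0 // ltz_nat.
- rewrite big_nat_recl //= lattice_term_neg // add0r; apply: eq_bigr => l _.
  by congr lattice_term; lia.
- rewrite big_nat_recl //= lattice_term_neg // add0r; apply: eq_bigr => l _.
  by congr lattice_term; lia.
Qed.

Lemma lattice0 i j : lattice 0 0 i j = ((i == 0) && (j == 0))%:R.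
Proof.
rewrite /lattice big_nat1 /lattice_term /=.
have -> : 0%:Z - 0%:Z - i - j = - (i + j) by lia.
have -> : 0%:Z + i + j = i + j by lia.
have -> : 0%:Z + i = i by lia.
have -> : 0%:Z + j = j by lia.
have [|] := boolP ((i == 0) && (j == 0)); first by case/andP=> /eqP-> /eqP->.
move=> H.
have : [|| i < 0, j < 0 | - (i + j) < 0] by lia.
by case/or3P=> /ifactN->; rewrite !(mulr0, mul0r).
Qed.

Lemma lattice_plane_walks n i j : lattice n n i j = plane_walks (lattice 0 0) n i j.
Proof.
elim: n i j => //= n IH i j; rewrite lattice_hstep /step /hstep.
by rewrite !lattice_vstep /vstep !IH.
Qed.

(** This symmetry and the next two preserve the set of six hexagonal steps and fix the origin, so
    they pass through [step]. *)
Lemma lattice_swap n i j : lattice n n j i = lattice n n i j.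
Proof.
rewrite !lattice_plane_walks; elim: n i j => [|n IH] i j /=; first by rewrite !lattice0 andbC.
by rewrite !stepE -/(plane_walks _ _) !(IH i) !(IH (i + 1)) !(IH (i - 1)); ring.
Qed.

Lemma lattice_opp n i j : lattice n n (- i) (- j) = lattice n n i j.
Proof.
rewrite !lattice_plane_walks; elim: n i j => [|n IH] i j /=.
  by rewrite !lattice0 !oppr_eq0.
have d1 (k : int) : - k + 1 = - (k - 1) by ring.
have d2 (k : int) : - k - 1 = - (k + 1) by ring.
by rewrite !stepE -/(plane_walks _ _) !d1 !d2 !IH; ring.
Qed.

Lemma lattice_rot n i j : lattice n n (- i - j) j = lattice n n i j.
Proof.
rewrite !lattice_plane_walks; elim: n i j => [|n IH] i j /=.
  by rewrite !lattice0; congr (nat_of_bool _)%:R; lia.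
rewrite !stepE -/(plane_walks _ _).
rewrite -(IH (i + 1) j) -(IH (i - 1) j) -(IH i (j + 1)) -(IH i (j - 1)).
rewrite -(IH (i + 1) (j - 1)) -(IH (i - 1) (j + 1)) -(IH i j).
have -> : - (i + 1) - j = - i - j - 1 by ring.
have -> : - (i - 1) - j = - i - j + 1 by ring.
have -> : - i - (j + 1) = - i - j - 1 by ring.
have -> : - i - (j - 1) = - i - j + 1 by ring.
have -> : - (i + 1) - (j - 1) = - i - j by ring.
have -> : - (i - 1) - (j + 1) = - i - j by ring.
ring.
Qed.

(** * The alternating sum over the dihedral orbit *)

(* The orbit of (0, 0) under the group generated by the reflections of [alternating]. *)
Definition signed_orbit : seq (int * int * int) :=
  [:: (0, 0, 1); (-1, -4, 1); (-5, 1, 1); (-1, 1, -1); (0, -4, -1); (-5, 0, -1);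
      (-4, -2, 1); (-3, 2, 1); (1, -3, 1); (-3, -3, -1); (-4, 2, -1); (1, -2, -1)].

Definition orbit_sum (f : int -> int -> rat) (a b : int) : rat :=
  \sum_(w <- signed_orbit) w.2%:~R * f (a - w.1.1) (b - w.1.2).

Lemma step_orbit_sum f a b : step (orbit_sum f) a b = orbit_sum (step f) a b.
Proof.
rewrite stepE /orbit_sum -sumrMnl -!big_split /=; apply: eq_bigr => w _.
rewrite stepE ![_ + 1 - _]addrAC ![_ - 1 - _]addrAC; ring.
Qed.

Lemma plane_walks_orbit_sum f n a b :
  plane_walks (orbit_sum f) n a b = orbit_sum (plane_walks f n) a b.
Proof.
elim: n a b => //= n IH a b; rewrite -[RHS]step_orbit_sum.
exact: eq_step.
Qed.

(** Each generating reflection permutes the orbit and flips all signs. *)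
Lemma alternating_orbit_sum : alternating (orbit_sum (lattice 0 0)).
Proof.
split=> a b; rewrite /orbit_sum -sumrN.
- pose r (w : int * int * int) := (w.1.2 - 1, w.1.1 + 1, - w.2).
  have pr : perm_eq signed_orbit (map r signed_orbit) by [].
  rewrite [RHS](perm_big _ pr) big_map; apply: eq_bigr => w _ /=.
  rewrite !lattice0 rmorphN mulNr opprK; congr (_ * (nat_of_bool _)%:R); lia.
- pose r (w : int * int * int) := (w.1.1 + w.1.2 + 1, - w.1.2 - 2, - w.2).
  have pr : perm_eq signed_orbit (map r signed_orbit) by [].
  rewrite [RHS](perm_big _ pr) big_map; apply: eq_bigr => w _ /=.
  rewrite !lattice0 rmorphN mulNr opprK; congr (_ * (nat_of_bool _)%:R); lia.
Qed.

Lemma orbit_sum_chamber (h b : nat) :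
  orbit_sum (lattice 0 0) (h + b)%N b = ((h == 0%N) && (b == 0%N))%:R.
Proof.
rewrite /orbit_sum big_cons big1_seq => [|w /= wo].
  by rewrite lattice0 mul1r addr0 /= !subr0; congr (nat_of_bool _)%:R; lia.
have : (w.1.2 < 0) || (w.1.1 < w.1.2) by move: w wo; apply/allP.
case: w {wo} => [[p q] c] /=; rewrite lattice0 => H.
rewrite (_ : (_ - p == 0) && (_ - q == 0) = false) ?mulr0 //; lia.
Qed.

(** The hexagonal symmetries move the twelve points to representatives (p - r - 1, r - q + 2) with
    small p, q, r, whose sums will share a common factor. *)
Lemma num_noncrossing_lattice m : (walks m.+1 0 0)%:R =
  lattice m m 0 0 - lattice m m (-1) 1 + lattice m m (-2) 3 *+ 2 - lattice m m (-1) 2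
  - lattice m m (-2) 4 - lattice m m (-4) 4 + lattice m m (-4) 5 *+ 2 - lattice m m (-5) 5
  + lattice m m (-4) 6 - lattice m m (-3) 6.
Proof.
(* Nothing can be removed from the empty shape, so the first half step is trivial and m full steps
   remain. *)
have -> : walks m.+1 0 0 = stay up (walks m) 0 0 by rewrite [LHS]/= {1}/stay /down !addn0.
rewrite (chamber_walks _ _ alternating_orbit_sum orbit_sum_chamber 0 0).
rewrite plane_walks_orbit_sum /orbit_sum !big_cons big_nil /= -!lattice_plane_walks.
pose N := lattice m m; rewrite -/N.
have sw i j : N j i = N i j := lattice_swap m i j.
have op i j : N (- i) (- j) = N i j := lattice_opp m i j.
have ro i j : N (- i - j) j = N i j := lattice_rot m i j.
rewrite !sub0r !opprK.
have -> : N 1 4 = N (-4) 5 by rewrite -(ro 1) -op sw.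
have -> : N 5 (-1) = N (-4) 5 by rewrite sw -ro.
have -> : N 1 (-1) = N (-1) 1 by rewrite sw.
have -> : N 0 4 = N (-4) 4 by rewrite -ro.
have -> : N 5 0 = N (-5) 5 by rewrite sw -ro.
have -> : N 4 2 = N (-4) 6 by rewrite sw -ro -op sw.
have -> : N 3 (-2) = N (-2) 3 by rewrite sw.
have -> : N (-1) 3 = N (-2) 3 by rewrite -ro.
have -> : N 3 3 = N (-3) 6 by rewrite -ro -op sw.
have -> : N 4 (-2) = N (-2) 4 by rewrite sw.
rewrite !mul1r; ring.
Qed.

(** * The hypergeometric sum *)

Fixpoint falling (x : int) (d : nat) : rat :=
  if d is d'.+1 then x%:~R * falling (x - 1) d' else 1.

Lemma ifact_falling (d : nat) (y x : int) : x + d = y -> ifact x = falling y d * ifact y.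
Proof.
elim: d x y => [|d IH] x y e /=; first by rewrite mul1r; congr ifact; lia.
by rewrite (IH x (y - 1)) ?ifact_pred; [ring|lia].
Qed.

Lemma zfact_falling (d : nat) (y x : int) : 0 <= y -> x = y + d ->
  zfact x = falling x d * zfact y.
Proof.
move=> y0; elim: d x => [|d IH] x e /=; first by rewrite mul1r; congr zfact; lia.
by rewrite zfact_pred ?(IH (x - 1)); [ring|lia|lia].
Qed.

(** The denominators are those of the claimed summand at n = m + 1, j = z. With z = l + p, each
    lattice summand in use is this times a polynomial, [weight]. *)
Definition base_term (m : nat) (z : int) : rat :=
  m`!%:R * m`!%:R * zfact (2 * z - 2) * ifact z * ifact (z + 1) * ifact (z - 1)
  * ifact (z + 4) * ifact (m%:Z - z + 3) * ifact (m%:Z - z + 1).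

Definition weight (m : nat) (z : int) (p q r : nat) : rat :=
  falling (2 * z + 1 - p%:Z - q%:Z) (3 - (p + q)) * falling z p * falling (z + 1) q
  * falling (z - 1) r * falling (z + 4) (p + q + 2 - r)
  * falling (m%:Z - z + 3) (3 - p) * falling (m%:Z - z + 1) (2 - q).

Lemma lattice_term_weight m (z : int) (p q r : nat) :
  0 < z -> (p + q <= 3)%N -> (q <= 2)%N -> (r <= p + q + 2)%N ->
  lattice_term m m (p%:Z - r%:Z - 1) (r%:Z - q%:Z + 2) (z - p%:Z)
  = base_term m z * weight m z p q r.
Proof.
move=> z0 pq q2 rpq; rewrite /lattice_term.
rewrite (@zfact_falling (3 - (p + q)) (2 * z - 2)); [|lia|lia].
rewrite (@ifact_falling p z (z - p%:Z)); last by lia.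
rewrite (@ifact_falling q (z + 1) (_ + _ + _)); last by lia.
rewrite (@ifact_falling r (z - 1) (_ + (p%:Z - _ - _))); last by lia.
rewrite (@ifact_falling (p + q + 2 - r) (z + 4) (_ + (r%:Z - _ + _))); last by lia.
rewrite (@ifact_falling (3 - p) (m%:Z - z + 3) (m%:Z - (z - p%:Z))); last by lia.
rewrite (@ifact_falling (2 - q) (m%:Z - z + 1) (_ - _ - _ - _)); last by lia.
rewrite /base_term /weight.
have -> : z - p%:Z + (z - p%:Z) + (p%:Z - r%:Z - 1) + (r%:Z - q%:Z + 2)
        = 2 * z + 1 - p%:Z - q%:Z by lia.
by ring.
Qed.

Lemma sum_shift m (F : int -> rat) (d : int) : F d = 0 -> F (m.+1%:Z + d) = 0 ->
  \sum_(1 <= k < m.+2) F (k%:Z + (d - 1)) = \sum_(1 <= k < m.+2) F (k%:Z + d).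
Proof.
move=> F0 Fm; rewrite [LHS]big_add1 [RHS]big_nat_recr //= Fm addr0.
rewrite big_nat_recl // [RHS]big_add1 /=.
have -> : 1%:Z + (d - 1) = d by lia.
rewrite F0 add0r; apply: eq_bigr => k _; congr F; lia.
Qed.

(** Setting k = l + p puts all sums on the range 1, ..., m + 1; terms gained or lost at the ends
    contain the reciprocal factorial of a negative integer. *)
Lemma lattice_weight m (p q r : nat) : (p + q <= 3)%N -> (q <= 2)%N -> (r <= p + q + 2)%N ->
  lattice m m (p%:Z - r%:Z - 1) (r%:Z - q%:Z + 2)
  = \sum_(1 <= k < m.+2) base_term m k * weight m k p q r.
Proof.
move=> pq q2 rpq; set i := _ - 1; set j := _ + 2.
have -> : lattice m m i j = \sum_(1 <= k < m.+2) lattice_term m m i j (k%:Z + - p%:Z); last first.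
  by apply: eq_big_nat => k /andP[k0 _]; apply: lattice_term_weight.
have S1 : lattice m m i j = \sum_(1 <= k < m.+2) lattice_term m m i j (k%:Z + (0 - 1)).
  by rewrite big_add1 /=; apply: eq_bigr => l _; congr lattice_term; lia.
case: (posnP p) => [p0|p0].
  rewrite S1 sum_shift ?p0 ?oppr0 //; last by rewrite lattice_term_big //; lia.
  by rewrite /lattice_term (ifactN (0 + i)) ?(mulr0, mul0r) // /i; lia.
suff H (d : nat) : (d < p)%N ->
    lattice m m i j = \sum_(1 <= k < m.+2) lattice_term m m i j (k%:Z + - d.+1%:Z).
  by rewrite (H p.-1) ?prednK //; lia.
elim: d => [|d IH] dp; first by rewrite S1.
rewrite IH ?(ltnW dp) // -sum_shift; first by apply: eq_bigr => k _; congr lattice_term; lia.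
  by rewrite lattice_term_neg.
by rewrite /lattice_term (ifactN (_ - _ - i - j)) ?mulr0 // /i /j; lia.
Qed.

(* Found by Gosper's algorithm. The sums for the two weights of the neighbours (-1, 1)
   and (0, 1) of the origin agree, but not term by term up to telescoping; adding a
   rational multiple of their difference makes the total summand telescope. *)
Definition cert (M Z : rat) : rat :=
  (336 + 456 * M + 120 * M ^+ 2) * (M + 2)
  + (496 + 724 * M + 500 * M ^+ 2 + 194 * M ^+ 3 + 30 * M ^+ 4) * Z
  + (- 3408 - 4742 * M - 2218 * M ^+ 2 - 383 * M ^+ 3 - 15 * M ^+ 4) * Z ^+ 2
  + (2920 + 2636 * M + 761 * M ^+ 2 + 109 * M ^+ 3 + 15 * M ^+ 4) * Z ^+ 3
  + (- 704 - 738 * M - 314 * M ^+ 2 - 58 * M ^+ 3) * Z ^+ 4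
  + (184 + 252 * M + 71 * M ^+ 2) * Z ^+ 5 + (- 64 - 28 * M) * Z ^+ 6.

(** The reciprocal factorials of z - 2 and m - z + 1 make it vanish at both ends z = 1 and z = m +
    2. *)
Definition primitive (m : nat) (z : int) : rat :=
  m`!%:R * m`!%:R * zfact (2 * z - 2) * ifact (z - 2) * ifact (z - 1) * ifact z
  * ifact (z + 3) * ifact (m%:Z - z + 3) * ifact (m%:Z - z + 1) * cert m%:R z%:~R.

Lemma primitive_diff m (z : int) : 0 < z ->
  primitive m (z + 1) - primitive m z = base_term m z *
   (2 * z%:~R * (2 * z%:~R - 1) * (m%:R - z%:~R + 3) * (m%:R - z%:~R + 1)
      * cert m%:R (z%:~R + 1)
    - (z%:~R - 1) * z%:~R * (z%:~R + 1) * (z%:~R + 4) * cert m%:R z%:~R).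
Proof.
move=> z0; rewrite /primitive /base_term.
rewrite (@zfact_falling 2 (2 * z - 2) (2 * (z + 1) - 2)); [|lia|lia].
have -> : z + 1 - 2 = z - 1 by lia.
have -> : z + 1 - 1 = z by lia.
have -> : z + 1 + 3 = z + 4 by lia.
rewrite (@ifact_falling 1 (z - 1) (z - 2)); last by lia.
rewrite (@ifact_falling 1 (z + 4) (z + 3)); last by lia.
rewrite (@ifact_falling 1 (m%:Z - z + 3) (m%:Z - (z + 1) + 3)); last by lia.
rewrite (@ifact_falling 1 (m%:Z - z + 1) (m%:Z - (z + 1) + 1)); last by lia.
have -> : ifact z = (z + 1)%:~R * ifact (z + 1) by rewrite -ifact_pred addrK.
have -> : ifact (z - 1) = z%:~R * ((z + 1)%:~R * ifact (z + 1)).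
  by rewrite -[in RHS](ifact_pred (z + 1)) addrK ifact_pred.
rewrite /= !(rmorphD, rmorphB, rmorphN, rmorph1, rmorphM) /=.
move: (cert _ _) (cert _ _) => c1 c2.
ring.
Qed.

(** The claimed summand at n = M + 1, j = Z, divided by [base_term]. *)
Definition summand (M Z : rat) : rat :=
  4 * (M + 1) * (2 * Z * (2 * Z - 1)) * Ppoly Z (M + 1).

(** The factor (M + 2)(M + 4) clears the denominator of the rational multiple of the difference of
    the two neighbour weights. *)
Lemma cert_correct m (z : int) :
  let M := m%:R : rat in let Z := z%:~R : rat in let W := weight m z in
  (M + 2) * (M + 4) * (W 1%N 2%N 0%N - W 0%N 1%N 0%N + W 1%N 1%N 2%N *+ 2
     - W 1%N 1%N 1%N - W 2%N 1%N 3%N - W 0%N 1%N 3%N + W 1%N 1%N 4%N *+ 2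
     - W 1%N 2%N 5%N + W 2%N 1%N 5%N - W 2%N 0%N 4%N - summand M Z)
  + 2 * (M ^+ 2 - M - 8) * (W 0%N 1%N 0%N - W 1%N 1%N 0%N)
  = 2 * Z * (2 * Z - 1) * (M - Z + 3) * (M - Z + 1) * cert M (Z + 1)
    - (Z - 1) * Z * (Z + 1) * (Z + 4) * cert M Z.
Proof.
move=> M Z W; rewrite /W /weight /= /summand /Ppoly /cert.
rewrite !(rmorphD, rmorphB, rmorphN, rmorph1, rmorphM) /= -/Z -/M.
ring.
Qed.

Lemma sum_summand m :
  lattice m m 0 0 - lattice m m (-1) 1 + lattice m m (-2) 3 *+ 2 - lattice m m (-1) 2
  - lattice m m (-2) 4 - lattice m m (-4) 4 + lattice m m (-4) 5 *+ 2 - lattice m m (-5) 5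
  + lattice m m (-4) 6 - lattice m m (-3) 6
  = \sum_(1 <= k < m.+2) base_term m k * summand m%:R k%:~R.
Proof.
have root_eq : lattice m m (-1) 1 - lattice m m 0 1 = 0.
  by rewrite -(lattice_rot _ 0 1) subrr.
pose S p q r := \sum_(1 <= k < m.+2) base_term m k * weight m k p q r.
have E p q r : (p + q <= 3)%N -> (q <= 2)%N -> (r <= p + q + 2)%N ->
    lattice m m (p%:Z - r%:Z - 1) (r%:Z - q%:Z + 2) = S p q r := @lattice_weight m p q r.
have -> : lattice m m 0 0 = S 1 2 0 by exact: (E 1 2 0).
have Ea : lattice m m (-1) 1 = S 0 1 0 by exact: (E 0 1 0).
have Eb : lattice m m 0 1 = S 1 1 0 by exact: (E 1 1 0).
have -> : lattice m m (-2) 3 = S 1 1 2 by exact: (E 1 1 2).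
have -> : lattice m m (-1) 2 = S 1 1 1 by exact: (E 1 1 1).
have -> : lattice m m (-2) 4 = S 2 1 3 by exact: (E 2 1 3).
have -> : lattice m m (-4) 4 = S 0 1 3 by exact: (E 0 1 3).
have -> : lattice m m (-4) 5 = S 1 1 4 by exact: (E 1 1 4).
have -> : lattice m m (-5) 5 = S 1 2 5 by exact: (E 1 2 5).
have -> : lattice m m (-4) 6 = S 2 1 5 by exact: (E 2 1 5).
have -> : lattice m m (-3) 6 = S 2 0 4 by exact: (E 2 0 4).
rewrite Ea; rewrite Ea Eb in root_eq.
set T := \sum_(1 <= k < _) _.
pose M : rat := m%:R.
have telescope : \sum_(1 <= k < m.+2) (primitive m k.+1 - primitive m k) = 0.
  rewrite (telescope_sumr (fun k : nat => primitive m k)) // /primitive.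
  rewrite (ifactN (_ - m.+2%:Z + 1)) ?(ifactN (1%:Z - 2)) ?(mulr0, mul0r, subrr) //; lia.
have : (M + 2) * (M + 4) * (S 1 2 0 - S 0 1 0 + S 1 1 2 *+ 2 - S 1 1 1 - S 2 1 3 - S 0 1 3
     + S 1 1 4 *+ 2 - S 1 2 5 + S 2 1 5 - S 2 0 4 - T)
  + 2 * (M ^+ 2 - M - 8) * (S 0 1 0 - S 1 1 0)
  = \sum_(1 <= k < m.+2) (primitive m k.+1 - primitive m k).
  rewrite /S /T -!sumrMnl -!sumrN -!big_split /= !mulr_sumr -big_split /=.
  apply: eq_big_nat => k /andP[k0 _].
  rewrite (_ : k.+1%:Z = k%:Z + 1); last by lia.
  rewrite (primitive_diff m k k0) -[X in _ = _ * X](cert_correct m k) -/M.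
  move: (weight m k) (summand M k%:~R) (base_term m k) => W U D; ring.
rewrite telescope root_eq mulr0 addr0 => /eqP.
have n2 : M + 2 != 0 by rewrite /M -natrD pnatr_eq0 addnS.
have n4 : M + 4 != 0 by rewrite /M -natrD pnatr_eq0 addnS.
by rewrite !mulf_eq0 (negPf n2) (negPf n4) /= subr_eq0 => /eqP.
Qed.

Lemma ifact_nat (k : nat) : ifact k = (k`!%:R)^-1.
Proof. by []. Qed.

Theorem proposition6 (n : nat) (hn : (1 <= n)%N) :
  (num_noncrossing 3 n)%:R =
  \sum_(1 <= j < n.+1)
     (4 * ((n - 1)`!)%:R * (n`!)%:R * ((2 * j)`!)%:R)
     / (((j - 1)`!)%:R * (j`!)%:R * ((j + 1)`!)%:R * ((j + 4)`!)%:R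
        * ((n - j)`!)%:R * ((n - j + 2)`!)%:R)
     * Ppoly j%:R n%:R :> rat.
Proof.
rewrite num_noncrossing_walks; case: n hn => // m _.
rewrite num_noncrossing_lattice sum_summand; apply: eq_big_nat => j /andP[j0 jm].
rewrite /base_term /summand.
rewrite (_ : j%:Z + 1 = (j + 1)%N); last by lia.
rewrite (_ : j%:Z + 4 = (j + 4)%N); last by lia.
rewrite (_ : j%:Z - 1 = (j - 1)%N); last by lia.
rewrite (_ : m%:Z - j%:Z + 3 = (m.+1 - j + 2)%N); last by lia.
rewrite (_ : m%:Z - j%:Z + 1 = (m.+1 - j)%N); last by lia.
rewrite -[j%:~R]/(j%:R) !ifact_nat (subn1 m.+1) /= factS.
have -> : (2 * j)`!%:R = 2 * j%:R * (2 * j%:R - 1) * zfact (2 * j%:Z - 2).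
  rewrite -[LHS]/(zfact (2 * j)%N) (@zfact_falling 2 (2 * j%:Z - 2)) /=; [|lia|lia].
  by rewrite PoszM !(rmorphD, rmorphB, rmorphN, rmorph1, rmorphM) /=; ring.
rewrite natrM -(natr1 m) !invfM.
move: (m`!)%:R (_ ^-1) (_ ^-1) (_ ^-1) (_ ^-1) (_ ^-1) (_ ^-1) (zfact _) (Ppoly _ _).
move=> a I0 I1 I2 I3 I4 I5 U V.
ring.
Qed.
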